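(* Let $C_n(x)$ denote the second-order Eulerian polynomials, let $C(x;z)=\sum_{n\geqslant 0}C_n(x)\frac{z^n}{n!}$, and define $L_n^{C}(x)$, $n\geqslant 1$, by $$\sum_{n\geqslant 1}L_n^{C}(x)\frac{z^n}{n!}=\frac{\partial}{\partial x}\ln C(x;z).$$ Then for every $n\geqslant 1$ the following identities of $n\times n$ determinants hold: $$\frac{\mathrm{d}}{\mathrm{d}x} C_n(x)= \begin{vmatrix} L_1^{C}(x) & -1 & 0 & \cdots & 0\\ L_2^{C}(x) & 2x & -1 & \cdots & 0\\ L_3^{C}(x) & 3C_1(x) & 3x & \cdots & 0\\ \vdots & \vdots & \vdots & \ddots & -1\\ L_n^{C}(x) & \binom n1C_{n-2}(x) & \binom n2C_{n-3}(x) & \cdots & \binom n{n-1}x \end{vmatrix},$$ and $L_n^C(x)$ can be computed by $$L_n^{C}(x)= \begin{vmatrix} 1 & -1 & 0 & \cdots & 0\\ \frac{\mathrm{d}}{\mathrm{d}x} C_1(x) & 2x & -1 & \cdots & 0\\ \frac{\mathrm{d}}{\mathrm{d}x} C_2(x) & 3C_1(x) & 3x & \cdots & 0\\ \vdots & \vdots & \vdots & \ddots & -1\\ \frac{\mathrm{d}}{\mathrm{d}x} C_{n-1}(x) & \binom n1C_{n-2}(x) & \binom n2C_{n-3}(x) & \cdots & \binom n{n-1}x \end{vmatrix}.$$ In both matrices, the $(i,i)$ entry is $\binom{i}{i-1}x$ for $2\leqslant i\leqslant n$, the $(i,j)$ entry is $\binom{i}{j-1}C_{i-j}(x)$ for $2\leqslant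 j<i\leqslant n$, the $(i,i+1)$ entries are $-1$, and the $(i,j)$ entries with $j>i+1$ are $0$. The $(i,1)$ entry of the first matrix is $L_i^C(x)$ for $1\leqslant i\leqslant n$; in the second matrix the $(1,1)$ entry is $1$ and the $(i,1)$ entry is $\frac{\mathrm{d}}{\mathrm{d}x}C_{i-1}(x)$ for $2\leqslant i\leqslant n$.
   Context: The second-order Eulerian polynomials $C_n(x)$ are defined by $C_0(x)=1$ and $C_n(x)=(2n-1)xC_{n-1}(x)+x(1-x)\frac{\mathrm{d}}{\mathrm{d}x}C_{n-1}(x)$ for $n\geqslant 1$; thus $C_1(x)=x$, $C_2(x)=x+2x^2$, $C_3(x)=x+8x^2+6x^3$. Equivalently, $C_n(x)=\sum_{\sigma}x^{\mathrm{des}(\sigma)}$, the sum being over all Stirling permutations $\sigma=\sigma_1\cdots\sigma_{2n}$ of the multiset $\{1,1,2,2,\ldots,n,n\}$ (arrangements in which, for each $i$, all letters between the two occurrences of $i$ are at least $i$), where $\mathrm{des}(\sigma)$ is the number of indices $i\in\{0,1,\ldots,2n\}$ with $\sigma_i>\sigma_{i+1}$, with $\sigma_0=\sigma_{2n+1}=0$. Generating functions are formal power series in $z$ with coefficients polynomials in $x$, and $\frac{\partial}{\partial x}\ln C(x;z)$ means $\left(\frac{\partial}{\partial x}C(x;z)\right)/C(x;z)$. *)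

(* Defs.v *)
From HB Require Import structures.
From mathcomp Require Import all_boot all_order all_algebra.
Set Implicit Arguments.
Unset Strict Implicit.
Unset Printing Implicit Defensive.
Import GRing.Theory Num.Theory.
Local Open Scope ring_scope.

(* [f] stands for the formal power series \sum_n f n * z^n. *)
Definition series (R : Type) : Type := nat -> R.

Section Series.
Variable R : comUnitRingType.
Implicit Types f g : series R.

Definition series_one : series R := fun n => (n == 0%N)%:R.

Definition series_mul f g : series R :=
  fun n => \sum_(i < n.+1) f i * g (n - i)%N.

(* The first n coefficients of 1/f, by solving f * (1/f) = 1 for one coefficient
   at a time; meaningful when f 0 is a unit (see series_mulV). *)
Fixpoint series_inv_coefs f (n : nat) : seq R :=
  if n is m.+1 then
    let s := series_inv_coefs f m in
    rcons s ((f 0%N)^-1 * ((m == 0%N)%:R - \sum_(i < m) s`_i * f (m - i)%N))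
  else [::].

Definition series_inv f : series R := fun n => (series_inv_coefs f n.+1)`_n.

Definition series_div f g : series R := series_mul f (series_inv g).

Lemma size_series_inv_coefs f n : size (series_inv_coefs f n) = n.
Proof. by elim: n => //= n IHn; rewrite size_rcons IHn. Qed.

Lemma nth_series_inv_coefs f n i :
  (i < n)%N -> (series_inv_coefs f n)`_i = series_inv f i.
Proof.
elim: n => // n IHn; rewrite ltnS leq_eqVlt => /predU1P[-> //|lt_in].
by rewrite /= nth_rcons size_series_inv_coefs lt_in IHn.
Qed.

Lemma series_mulV f : f 0%N \is a GRing.unit ->
  series_mul (series_inv f) f =1 series_one.
Proof.
move=> Uf n; rewrite /series_mul big_ord_recr /= subnn {2}/series_inv /=.
rewrite nth_rcons size_series_inv_coefs ltnn eqxx mulrC mulVKr //.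
rewrite -[RHS](subrKC (\sum_(i < n) series_inv f i * f (n - i)%N)).
congr (_ + (_ - _)); apply: eq_bigr => i _.
by rewrite nth_series_inv_coefs.
Qed.

End Series.

Fixpoint eulerian2 (n : nat) : {poly rat} :=
  if n is m.+1 then
    (2 * n - 1)%N%:R * 'X * eulerian2 m + 'X * (1 - 'X) * (eulerian2 m)^`()
  else 1.

(* Exponential generating function \sum_n a n * z^n / n!. *)
Definition egf (a : nat -> {poly rat}) : series {poly rat} :=
  fun n => (n`!%:R)^-1 *: a n.

Definition series_dx (f : series {poly rat}) : series {poly rat} :=
  fun n => (f n)^`().

Definition dx_ln (f : series {poly rat}) : series {poly rat} :=
  series_div (series_dx f) f.

(* The coefficients of d/dx ln C as an exponential generating function; its
   z^0 coefficient is 0 (see egf_LC), so the sum starts at n = 1. *)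
Definition LC (n : nat) : {poly rat} := n`!%:R *: dx_ln (egf eulerian2) n.

Lemma egf_LC n :
  (if n == 0%N then 0 else egf LC n) = dx_ln (egf eulerian2) n.
Proof.
case: n => [|n] /=; last first.
  by rewrite /egf /LC scalerA mulVf ?scale1r // pnatr_eq0 -lt0n fact_gt0.
rewrite /dx_ln /series_div /series_mul big_ord1 /series_dx /egf /=.
by rewrite derivZ derivC scaler0 mul0r.
Qed.

(* The first column is [c 1, ..., c n]; entries are described with row and
   column numbers starting at 1, whereas [\matrix] indices start at 0. *)
Definition eulerian2_mx (n : nat) (c : nat -> {poly rat}) : 'M[{poly rat}]_n :=
  \matrix_(i0 < n, j0 < n)
    let i := i0.+1 in let j := j0.+1 in
    if j == 1%N then c i
    else if j == i then 'C(i, (i - 1)%N)%:R * 'X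
    else if (j < i)%N then 'C(i, (j - 1)%N)%:R * eulerian2 (i - j)%N
    else if j == i.+1 then -1
    else 0.

Definition deriv_column (i : nat) : {poly rat} :=
  if i == 1%N then 1 else (eulerian2 (i - 1)%N)^`().

(* Main.v *)
Require Import Defs.
From mathcomp Require Import all_boot all_order all_algebra.
From mathcomp Require Import ring.
Import GRing.Theory.
Local Open Scope ring_scope.
Set Implicit Arguments.
Unset Strict Implicit.
Unset Printing Implicit Defensive.

(* With C = C(x;z), the recurrence defining C_n says
     (1 - 2xz) C_z - x (1 - x) C_x = x C,
   and the series D = 1 - x z - \sum_(n >= 2) C_(n-1) z^n/n! satisfies the same
   equation with right-hand side - x D.  Hence the product C D is annihilated by
   the first-order operator on the left, which forces C D = 1.  The entries of
   both matrices outside the first column are the coefficients of 1 - D, so a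
   Hessenberg determinant with first column c is the sequence solving u D = c.
   The two identities then read C_x D = C_x / C and (C_x / C) D = - D_x; the
   latter follows from differentiating C D = 1. *)

Section HessenbergDeterminant.
Variable R : comNzRingType.

Lemma det_hessenberg (n : nat) (A : 'M[R]_n.+1) (u : nat -> R) :
    (forall i j : 'I_n.+1, j = i.+1 :> nat -> A i j = -1) ->
    (forall i j : 'I_n.+1, (i.+1 < j)%N -> A i j = 0) ->
    u 0%N = 1 ->
    (forall i : 'I_n.+1, u i.+1 = \sum_(j < n.+1 | (j <= i)%N) A i j * u j) ->
  \det A = u n.+1.
Proof.
move=> A_sup A_far u0 uS.
(* A maps the column v of the u_j to u_(n+1) e_n; multiply by the adjugate. *)
pose v : 'cV[R]_n.+1 := \col_j u j.
have Av : A *m v = u n.+1 *: delta_mx ord_max 0.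
  apply/colP=> i; rewrite !mxE eqxx andbT.
  rewrite (bigID (fun j : 'I_n.+1 => (j <= i)%N)) /=.
  under eq_bigr do rewrite mxE.
  rewrite -uS; under eq_bigr => j do rewrite -ltnNge mxE.
  (* Beyond the diagonal only the superdiagonal entry survives and contributes [- u i.+1]; the last
     row has no such entry. *)
  have [lt_in|le_ni] := ltnP i n.
    have lt_i1n : (i.+1 < n.+1)%N by [].
    rewrite (bigD1 (Ordinal lt_i1n)) -?ltnNge //= A_sup // big1 => [|j].
      rewrite mulN1r addr0 subrr; case: eqP lt_in => [->|_ _]; last by rewrite mulr0.
      by rewrite ltnn.
    rewrite -ltnNge => /andP[lt_ij ne_j]; rewrite A_far ?mul0r //.
    by rewrite ltn_neqAle lt_ij eq_sym andbT; apply: contra ne_j => /eqP e; apply/eqP/val_inj.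
  have -> : i = ord_max by apply/val_inj/eqP; rewrite /= eqn_leq le_ni -ltnS ltn_ord.
  rewrite eqxx mulr1 big1 ?addr0 // => j; rewrite -ltnNge /= ltnNge.
  by rewrite -ltnS ltn_ord.
have /(congr1 (fun w : 'cV_n.+1 => w ord0 0)) : \det A *: v = \adj A *m (A *m v).
  by rewrite mulmxA mul_adj_mx mul_scalar_mx.
rewrite Av -scalemxAr -colE !mxE /= u0 mulr1 => ->.
(* Without the last row and first column, the superdiagonal becomes the diagonal: the minor is lower
   triangular with determinant [(-1) ^+ n], which cancels the cofactor sign. *)
rewrite /cofactor addn0 det_trig; last first.
  apply/is_trig_mxP=> i j lt_ij; rewrite !mxE A_far //.
  by rewrite lift_max lift0 ltnS.
rewrite (eq_bigr (fun=> -1)) => [|i _]; last first.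
  by rewrite !mxE A_sup // lift_max lift0.
by rewrite prodr_const card_ord -signr_odd -signr_addb addbb mulr1.
Qed.

End HessenbergDeterminant.

Section SeriesRing.
Variable R : comUnitRingType.
Implicit Types f g h : series R.

(* Coefficients of index at most [n] of a product of series can be computed in
   the polynomial ring, whence the commutative ring laws. *)
Lemma series_mul_coef (n : nat) f g (p q : {poly R}) :
    (forall i, (i <= n)%N -> p`_i = f i) -> (forall i, (i <= n)%N -> q`_i = g i) ->
  forall i, (i <= n)%N -> (p * q)`_i = series_mul f g i.
Proof.
move=> pf qg i le_in; rewrite coefM; apply: eq_bigr => j _.
rewrite pf ?qg //; first exact: leq_trans (leq_subr _ _) le_in.
by apply: leq_trans le_in; rewrite -ltnS ltn_ord.
Qed.

Let trunc_coef n f i : (i <= n)%N -> (\poly_(j < n.+1) f j)`_i = f i.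
Proof. by move=> le_in; rewrite coef_poly ltnS le_in. Qed.

Lemma series_mulC f g : series_mul f g =1 series_mul g f.
Proof.
move=> n; have fT := @trunc_coef n f; have gT := @trunc_coef n g.
by rewrite -(series_mul_coef fT gT) // mulrC (series_mul_coef gT fT).
Qed.

Lemma series_mulA f g h :
  series_mul f (series_mul g h) =1 series_mul (series_mul f g) h.
Proof.
move=> n; have fT := @trunc_coef n f; have gT := @trunc_coef n g.
have hT := @trunc_coef n h.
rewrite -(series_mul_coef fT (series_mul_coef gT hT)) // mulrA.
exact: (series_mul_coef (series_mul_coef fT gT) hT).
Qed.

Lemma eq_series_mul f f' g g' :
  f =1 f' -> g =1 g' -> series_mul f g =1 series_mul f' g'.
Proof. by move=> ff' gg' n; apply: eq_bigr => i _; rewrite ff' gg'. Qed.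

Lemma series_mul1 f : series_mul f (@series_one R) =1 f.
Proof.
move=> n; rewrite series_mulC /series_mul big_ord_recl subn0 mul1r big1 ?addr0 //.
by move=> i _; rewrite mul0r.
Qed.

Lemma series_inv_unique f g : f 0%N \is a GRing.unit ->
  series_mul f g =1 @series_one R -> series_inv f =1 g.
Proof.
move=> Uf fg n; rewrite -[LHS]series_mul1.
rewrite -(@eq_series_mul (series_inv f) _ _ _ (frefl _) fg) series_mulA.
by rewrite (eq_series_mul (series_mulV Uf) (frefl g)) series_mulC series_mul1.
Qed.

End SeriesRing.

Lemma natr_poly_neq0 (n : nat) : (n.+1%:R : {poly rat}) != 0.
Proof. by rewrite -polyC_natr polyC_eq0 Num.Theory.pnatr_eq0. Qed.

Lemma factr_neq0 (n : nat) : (n`!%:R : rat) != 0.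
Proof. by rewrite Num.Theory.pnatr_eq0 -lt0n fact_gt0. Qed.

(** Differentiation in z shifts the sequence of an exponential generating function. *)
Lemma egfS (a : nat -> {poly rat}) (n : nat) :
  n.+1%:R * egf a n.+1 = (n`!%:R)^-1 *: a n.+1.
Proof.
rewrite /egf factS natrM mulr_natl -scaler_nat scalerA invfM mulrA divff ?mul1r //.
by rewrite Num.Theory.pnatr_eq0.
Qed.

(** Links series to matrices: these binomial convolutions are the row sums of the determinants. *)
Lemma egf_mul (a b : nat -> {poly rat}) (n : nat) :
  n`!%:R *: series_mul (egf a) (egf b) n =
  \sum_(i < n.+1) 'C(n, i)%:R * (a i * b (n - i)%N).
Proof.
rewrite scaler_sumr; apply: eq_bigr => i _.
have le_in : (i <= n)%N by rewrite -ltnS.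
rewrite -scalerAl -scalerAr !scalerA [RHS]mulr_natl -scaler_nat; congr (_ *: _).
rewrite -(bin_fact le_in) !natrM.
have := factr_neq0 i; have := factr_neq0 (n - i).
by move=> ? ?; field; apply/andP.
Qed.

Lemma series_dx_mul (f g : series {poly rat}) (n : nat) :
  series_dx (series_mul f g) n =
  series_mul (series_dx f) g n + series_mul f (series_dx g) n.
Proof.
rewrite /series_dx /series_mul raddf_sum -big_split.
by apply: eq_bigr => i _; apply: derivM.
Qed.

(** Leibniz rule in z: split the weight [n.+1] as i + (n + 1 - i) in each term, then drop the end
    term of weight 0 from each sum. *)
Lemma series_dz_mul (f g : series {poly rat}) (n : nat) :
  n.+1%:R * series_mul f g n.+1 =
  \sum_(i < n.+1) (i.+1%:R * f i.+1 * g (n - i)%N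
                   + f i * ((n - i).+1%:R * g (n - i).+1)).
Proof.
rewrite big_split /=.
have -> : n.+1%:R * series_mul f g n.+1 =
    \sum_(i < n.+2) (i%:R * f i * g (n.+1 - i)%N)
  + \sum_(i < n.+2) (f i * ((n.+1 - i)%:R * g (n.+1 - i)%N)).
  rewrite -big_split /= /series_mul mulr_sumr; apply: eq_bigr => i _.
  have -> : n.+1%:R = i%:R + (n.+1 - i)%:R :> {poly rat}.
    by rewrite -natrD subnKC // -ltnS.
  by rewrite mulrDl mulrA [f i * _]mulrCA.
congr (_ + _).
  rewrite big_ord_recl !mul0r add0r; apply: eq_bigr => i _.
  by rewrite subSS.
rewrite big_ord_recr /= subnn mul0r mulr0 addr0; apply: eq_bigr => i _.
by rewrite subSn // -ltnS.
Qed.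

(** Index 1 is exceptional: [- 'X], not [- eulerian2 0], matching the special diagonal of the
    matrices. *)
Definition eulerian2_recip (n : nat) : {poly rat} :=
  match n with
  | 0 => 1
  | 1 => - 'X
  | m.+2 => - eulerian2 m.+1
  end.

Notation C := (egf eulerian2).
Notation D := (egf eulerian2_recip).

Lemma egf_eulerian2_rec (n : nat) :
  n.+1%:R * C n.+1 = (2 * n%:R + 1) * 'X * C n + 'X * (1 - 'X) * (C n)^`().
Proof.
rewrite egfS /egf derivZ -!scalerAr -scalerDr /=; congr (_ *: (_ * _ * _ + _)).
by rewrite mulnS addSn subn1 /= addnC natrD natrM.
Qed.

(* For n >= 2 this is the recurrence of C_(n-1); only n = 0, 1 need a check. *)
Lemma eulerian2_recip_rec (n : nat) :
  eulerian2_recip n.+1 =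
  (2 * n%:R - 1) * 'X * eulerian2_recip n
  + 'X * (1 - 'X) * (eulerian2_recip n)^`().
Proof.
case: n => [|[|n]].
- by rewrite /= derivC; ring.
- by rewrite /= (_ : (2 * 1 - 1)%N = 1%N) // derivN derivX derivC; ring.
have -> : eulerian2_recip n.+3 = - ((2 * n.+2 - 1)%N%:R * 'X * eulerian2 n.+1
    + 'X * (1 - 'X) * (eulerian2 n.+1)^`()) by [].
have -> : eulerian2_recip n.+2 = - eulerian2 n.+1 by [].
rewrite derivN natrB ?natrM; first by ring.
by rewrite mulnS.
Qed.

Lemma egf_recip_rec (n : nat) :
  n.+1%:R * D n.+1 = (2 * n%:R - 1) * 'X * D n + 'X * (1 - 'X) * (D n)^`().
Proof.
by rewrite egfS eulerian2_recip_rec /egf derivZ -!scalerAr -scalerDr.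
Qed.

Lemma eulerian2_mul_recip : series_mul C D =1 @series_one _.
Proof.
(* The factors 2i + 1 and 2(n - i) - 1 of the two recurrences add up to 2n; the derivative terms
   combine by Leibniz in x. *)
have rec n : n.+1%:R * series_mul C D n.+1 =
    2 * n%:R * 'X * series_mul C D n + 'X * (1 - 'X) * (series_mul C D n)^`().
  rewrite -[_^`()]/(series_dx _ n) series_dx_mul series_dz_mul /series_mul.
  rewrite -big_split /= !mulr_sumr -big_split /=.
  apply: eq_bigr => i _; rewrite egf_eulerian2_rec egf_recip_rec /series_dx.
  have -> : n%:R = i%:R + (n - i)%:R :> {poly rat} by rewrite -natrD subnKC // -ltnS.
  by ring.
have at0 : series_mul C D 0%N = 1.
  by rewrite /series_mul big_ord1 /egf /= invr1 !scale1r mulr1.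
case=> [|n]; first by rewrite at0.
(* The coefficient 1 at index 0 does not propagate, since both 2n and its derivative vanish there;
   from index 1 on, zero propagates. *)
elim: n => [|n IHn].
  apply: (mulfI (natr_poly_neq0 0)); rewrite rec.
  by rewrite at0 derivC /series_one /=; ring.
apply: (mulfI (natr_poly_neq0 n.+1)); rewrite rec.
by rewrite IHn /series_one /= deriv0; ring.
Qed.

Lemma dx_ln_eulerian2 : dx_ln C =1 series_mul (series_dx C) D.
Proof.
apply: eq_series_mul => //; apply: series_inv_unique eulerian2_mul_recip.
by rewrite /egf invr1 scale1r unitr1.
Qed.

Lemma dx_recip (n : nat) : series_mul (dx_ln C) D n = - series_dx D n.
Proof.
have dxCD m : series_mul (series_dx C) D m = - series_mul C (series_dx D) m.
  apply/eqP; rewrite -addr_eq0 -series_dx_mul /series_dx eulerian2_mul_recip.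
  by rewrite /series_one derivMn derivC mul0rn.
(* The chain is (C_x / C) D = (C_x D) D = - (C D_x) D = - D_x (C D) = - D_x. *)
transitivity (series_mul (fun m => - series_mul C (series_dx D) m) D n).
  by apply: eq_series_mul => // m; rewrite dx_ln_eulerian2.
transitivity (- series_mul (series_mul C (series_dx D)) D n).
  by rewrite /series_mul -sumrN; apply: eq_bigr => i _; rewrite mulNr.
congr (- _).
have -> : series_dx D n = series_mul (series_dx D) (series_mul C D) n.
  rewrite -[LHS]series_mul1; apply: eq_series_mul => // m.
  by rewrite eulerian2_mul_recip.
rewrite series_mulA; apply: eq_series_mul => // m.
exact: series_mulC.
Qed.

Lemma det_eulerian2_mx (n : nat) (c u : nat -> {poly rat}) :
    u 0%N = 0 ->
    (forall m, c m.+1 = \sum_(i < m.+2) 'C(m.+1, i)%:R * (u i * eulerian2_recip (m.+1 - i))) ->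
  \det (eulerian2_mx n.+1 c) = u n.+1.
Proof.
move=> u0 cE.
(* The first column [c] must carry weight 1, whereas [u 0] is 0; hence the altered initial value. *)
pose w i := if i is 0 then 1 else u i.
rewrite (@det_hessenberg _ n _ w) //.
- move=> i j ji; rewrite mxE ji /= eqSS eqn_leq ltnn /= ltnS ltnNge leqnSn /=.
  by rewrite eqxx.
- move=> i j lt_ij; rewrite mxE /= eqSS.
  case: (j : nat) lt_ij => // k; rewrite ltnS => lt_ik /=.
  by rewrite !eqSS ltnS ltnNge (gtn_eqF lt_ik) (gtn_eqF (leqW lt_ik)) (leqW (ltnW lt_ik)).
move=> i.
transitivity (\sum_(j < i.+1) eulerian2_mx n.+1 c i (inord j) * w j); last first.
  rewrite (big_ord_widen n.+1 (fun j => eulerian2_mx n.+1 c i (inord j) * w j)) //.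
  by apply: eq_bigr => j _; rewrite inord_val.
rewrite big_ord_recl mxE inordK //= mulr1 cE.
rewrite big_ord_recl u0 mul0r mulr0 add0r big_ord_recr /= subnn binn.
rewrite mul1r mulr1 addrAC addrC -[LHS]addr0; congr (_ + _).
(* Once the term [u i.+1] is isolated, each remaining convolution term cancels the matrix entry in
   the same column. *)
apply/esym; rewrite -big_split big1 //= => k _.
have lt_kn : (k.+1 < n.+1)%N by rewrite ltnS (leq_trans (ltn_ord k)) // -ltnS.
rewrite mxE /= inordK ?lift0 // !eqSS !ltnS /bump leq0n add1n subn1 !subSS /=.
case: eqP => [eq_ki|/eqP ne_ki].
  by have := subSnn k; rewrite eq_ki => -> /=; ring.
have lt_ki : (k.+1 < i)%N by rewrite ltn_neqAle ne_ki ltn_ord.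
rewrite lt_ki -(subnSK (ltnW lt_ki)) -(subnSK lt_ki) /=.
by ring.
Qed.

Theorem theorem3p2 (n : nat) (n_ge1 : (1 <= n)%N) :
  (eulerian2 n)^`() = \det (eulerian2_mx n LC) /\
  LC n = \det (eulerian2_mx n deriv_column).
Proof.
case: n n_ge1 => // n _.
have LC0 : LC 0 = 0 by rewrite /LC -egf_LC scaler0.
have egfLC : egf LC =1 dx_ln C.
  by case=> [|m]; rewrite -egf_LC //= /egf LC0 scaler0.
split; apply/esym.
  (* The row relation here is C_x D = C_x / C. *)
  rewrite (@det_eulerian2_mx _ _ (fun m => (eulerian2 m)^`())) ?derivC // => m.
  rewrite -(egf_mul (fun m => (eulerian2 m)^`()) _ m.+1) /LC dx_ln_eulerian2; congr (_ *: _).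
  by apply: eq_series_mul => // k; rewrite /series_dx /egf derivZ.
(* Here it is (C_x / C) D = - D_x; the exceptional [- 'X] in [D] yields the entry 1 of
   [deriv_column]. *)
rewrite (@det_eulerian2_mx _ _ LC) // => m.
rewrite -(egf_mul LC _ m.+1) (eq_series_mul egfLC (frefl _)) dx_recip /series_dx /egf.
rewrite derivZ -scalerN scalerA divff ?factr_neq0 // scale1r.
case: m => [|m]; rewrite /deriv_column /= derivN opprK //; first exact/esym/derivX.
Qed.
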